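(* Let $\Lambda\subset\mathbb{R}^2$ and $\Omega\subset\mathbb{R}^m$ be open, $x=(x^1,x^2)$, $m\ge 2$, and let $\mathcal{M}(2)=[\mathcal{R}_{p,q}]_{1\le p,q\le m}$ be the matrix operator (associated with a system of second order nonlinear partial differential equations with two independent variables) with $$\mathcal{R}_{p,p}=f_{p,p,0,1}\mathrm{D}_{0,1}+f_{p,p,1,1}\mathrm{D}_{1,1}+f_{p,p,1,2}\mathrm{D}_{1,2}+f_{p,p,2,1}\mathrm{D}_{2,1}+f_{p,p,2,2}\mathrm{D}_{2,2}+f_{p,p,2,3}\mathrm{D}_{2,3}+f_{p,p,2,4}\mathrm{D}_{2,4},$$ $$\mathcal{R}_{p,q}=f_{p,q,0,1}\mathrm{D}_{0,1}+f_{p,q,1,1}\mathrm{D}_{1,1}+f_{p,q,1,2}\mathrm{D}_{1,2}\quad(p\ne q),$$ where the coefficients $f_{p,q,k,h}=f_{p,q,k,h}(x,u^1,\dots,u^m)$ belong to $\mathcal{C}(\Lambda\times\Omega,\mathbb{R})$. A necessary and sufficient condition for $\mathcal{M}(2)$ to be decomposed into the form $\mathcal{M}(2)=\mathcal{N}_1(1)\cdot\mathcal{N}_2(1)$, where for $i=1,2$, $\mathcal{N}_i(1)=[\mathcal{T}_{i,p,q}]_{1\le p,q\le m}$ with $$\mathcal{T}_{i,p,p}=a_{i,p,p,0,1}\mathrm{D}_{0,1}+a_{i,p,p,1,1}\mathrm{D}_{1,1}+a_{i,p,p,1,2}\mathrm{D}_{1,2},\qquad \mathcal{T}_{i,p,q}=a_{i,p,q,0,1}\mathrm{D}_{0,1}\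 \ (p\ne q),$$ with coefficients depending on $(x,u^1,\dots,u^m)$, $a_{1,p,q,k,h}\in\mathcal{C}(\Lambda\times\Omega,\mathbb{R})$ and $a_{2,p,q,k,h}\in\mathcal{C}^1(\Lambda\times\Omega,\mathbb{R})$, is that, with $\mathcal{L}_p=a_{1,p,p,1,1}\mathrm{D}_{1,1}+a_{1,p,p,1,2}\mathrm{D}_{1,2}$, for all $p\in\{1,\dots,m\}$, \begin{align*} f_{p,p,0,1}&=\sum_{l=1}^m a_{1,p,l,0,1}a_{2,l,p,0,1}+\mathcal{L}_p(a_{2,p,p,0,1}),\\ f_{p,p,1,1}&=a_{1,p,p,0,1}a_{2,p,p,1,1}+a_{1,p,p,1,1}a_{2,p,p,0,1}+\mathcal{L}_p(a_{2,p,p,1,1})+a_{1,p,p,1,1}\mathrm{D}_{1,p+2}(a_{2,p,p,0,1})\,u^p,\\ f_{p,p,1,2}&=a_{1,p,p,0,1}a_{2,p,p,1,2}+a_{1,p,p,1,2}a_{2,p,p,0,1}+\mathcal{L}_p(a_{2,p,p,1,2})+a_{1,p,p,1,2}\mathrm{D}_{1,p+2}(a_{2,p,p,0,1})\,u^p,\\ f_{p,p,2,1}&=a_{1,p,p,1,1}a_{2,p,p,1,1},\\ f_{p,p,2,2}+f_{p,p,2,3}&=a_{1,p,p,1,2}a_{2,p,p,1,1}+a_{1,p,p,1,1}a_{2,p,p,1,2},\\ f_{p,p,2,4}&=a_{1,p,p,1,2}a_{2,p,p,1,2},\\ 0&=\mathrm{D}_{1,\tilde h+2}(a_{2,p,p,0,1}),\quad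 \tilde h\in\{1,2,\dots,m\}\setminus\{p\},\\ 0&=\mathrm{D}_{1,\tilde h+2}(a_{2,p,p,1,1}),\quad \tilde h=1,2,\dots,m,\\ 0&=\mathrm{D}_{1,\tilde h+2}(a_{2,p,p,1,2}),\quad \tilde h=1,2,\dots,m, \end{align*} and for all $p\ne q$ in $\{1,\dots,m\}$, \begin{align*} f_{p,q,0,1}&=\sum_{l=1}^m a_{1,p,l,0,1}a_{2,l,q,0,1}+\mathcal{L}_p(a_{2,p,q,0,1}),\\ f_{p,q,1,1}&=a_{1,p,p,1,1}a_{2,p,q,0,1}+a_{1,p,q,0,1}a_{2,q,q,1,1}+a_{1,p,p,1,1}\mathrm{D}_{1,q+2}(a_{2,p,q,0,1})\,u^q,\\ f_{p,q,1,2}&=a_{1,p,p,1,2}a_{2,p,q,0,1}+a_{1,p,q,0,1}a_{2,q,q,1,2}+a_{1,p,p,1,2}\mathrm{D}_{1,q+2}(a_{2,p,q,0,1})\,u^q,\\ 0&=\mathrm{D}_{1,\tilde h+2}(a_{2,p,q,0,1}),\quad \tilde h\in\{1,2,\dots,m\}\setminus\{q\}. \end{align*}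
   Context: For a scalar function $w=w(x^1,x^2)$: $\mathrm{D}_{0,1}w=w$, $\mathrm{D}_{1,1}w=w_{x^1}$, $\mathrm{D}_{1,2}w=w_{x^2}$, $\mathrm{D}_{2,1}w=\frac{\partial^2w}{(\partial x^1)^2}$, $\mathrm{D}_{2,2}w=\frac{\partial}{\partial x^2}\frac{\partial w}{\partial x^1}$, $\mathrm{D}_{2,3}w=\frac{\partial}{\partial x^1}\frac{\partial w}{\partial x^2}$, $\mathrm{D}_{2,4}w=\frac{\partial^2w}{(\partial x^2)^2}$. For a function $a(x^1,x^2,u^1,\dots,u^m)$ on $\Lambda\times\Omega$, regarded as a function of $m+2$ independent variables, $\mathrm{D}_{1,1}(a)=\partial a/\partial x^1$, $\mathrm{D}_{1,2}(a)=\partial a/\partial x^2$ and $\mathrm{D}_{1,\tilde h+2}(a)=\partial a/\partial u^{\tilde h}$ for $\tilde h=1,\dots,m$. Matrix operators act on $u={}^t(u^1,\dots,u^m)\in\mathcal{C}^2(\Lambda_0,\Omega)$, $\Lambda_0\subset\Lambda$ open, by $\mathcal{M}(2)u=\big[\sum_{q=1}^m\mathcal{R}_{p,q}u^q\big]_{1\le p\le m}$, all coefficients (of $\mathcal{M}(2)$, $\mathcal{N}_1(1)$ and $\mathcal{N}_2(1)$) being evaluated at $(x,u^1(x),\dots,u^m(x))$ for the original function $u$. The product is the matrix product with composition of entries: the $(p,q)$ entry of $\mathcal{N}_1(1)\cdot\mathcal{N}_2(1)$ is $\widetilde{\mathcal{R}}_{p,q}=\sum_{l=1}^m\mathcal{T}_{1,p,l}\mathcal{T}_{2,l,q}$,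 where $\widetilde{\mathcal{R}}_{p,q}u^q$ is obtained by applying to $u^q$ first $\mathcal{T}_{2,l,q}$ and then $\mathcal{T}_{1,p,l}$ (total derivatives with respect to $x^1,x^2$ being taken along $u(x)$). The equality $\mathcal{M}(2)=\mathcal{N}_1(1)\cdot\mathcal{N}_2(1)$ is an identity of matrix operators, obtained by identifying $\mathcal{R}_{p,q}u^q$ with $\widetilde{\mathcal{R}}_{p,q}u^q$ for all $1\le p,q\le m$.
   Formalization: Necessity is false in degenerate cases (f=0, a_1=0, a_2 depending on u); it is stated for given a_1,a_2 when each L_p is nonzero on a dense set, and for existence of a_1,a_2 when, for each p, f_{p,p,2,1}, f_{p,p,2,2}+f_{p,p,2,3}, f_{p,p,2,4} are not all 0 on a dense set. *)

(* Defs.v *)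
From HB Require Import structures.
From mathcomp Require Import all_boot all_order all_algebra.
From mathcomp Require Import all_classical all_reals all_analysis.

Set Implicit Arguments.
Unset Strict Implicit.
Unset Printing Implicit Defensive.

Import Order.TTheory GRing.Theory Num.Theory.
Import numFieldNormedType.Exports.

Local Open Scope classical_set_scope.
Local Open Scope ring_scope.

Section RegularFunctions.
Context {R : realType}.

Definition partial n (i : 'I_n) (g : 'rV[R]_n -> R) : 'rV[R]_n -> R :=
  fun z => 'D_(delta_mx 0 i) g z.

(* Regularity on A is meant for open A; values outside A are irrelevant. *)
Definition C0_on n (A : set 'rV[R]_n) (g : 'rV[R]_n -> R) : Prop :=
  forall z, A z -> {for z, continuous g}.

Definition C1_on n (A : set 'rV[R]_n) (g : 'rV[R]_n -> R) : Prop :=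
  (forall z, A z -> differentiable g z) /\
  (forall i, C0_on A (partial i g)).

Definition C2_on n (A : set 'rV[R]_n) (g : 'rV[R]_n -> R) : Prop :=
  C1_on A g /\ (forall i, C1_on A (partial i g)).

End RegularFunctions.

Section Operators.
Context {R : realType} {m : nat}.

(* A function of (x^1, x^2, u^1, .., u^m) is a function on 'rV_(2 + m); the
   point (x, u) is row_mx x u. *)
Definition prod_dom (Lambda : set 'rV[R]_2) (Omega : set 'rV[R]_m) :
  set 'rV[R]_(2 + m) :=
  [set z | Lambda (lsubmx z) /\ Omega (rsubmx z)].

Definition x1 : 'I_2 := ord0.
Definition x2 : 'I_2 := ord_max.

Definition Dx (i : 'I_2) (a : 'rV[R]_(2 + m) -> R) : 'rV[R]_(2 + m) -> R :=
  partial (lshift m i) a.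

Definition Du (h : 'I_m) (a : 'rV[R]_(2 + m) -> R) : 'rV[R]_(2 + m) -> R :=
  partial (rshift 2 h) a.

Definition ucoord (h : 'I_m) (z : 'rV[R]_(2 + m)) : R := z 0 (rshift 2 h).

(* f_{p,q,k,h} is fkh p q for k = 0, 1, and f_{p,p,2,h} is f2h p. *)
Record coeffs2 := Coeffs2 {
  f01 : 'I_m -> 'I_m -> 'rV[R]_(2 + m) -> R;
  f11 : 'I_m -> 'I_m -> 'rV[R]_(2 + m) -> R;
  f12 : 'I_m -> 'I_m -> 'rV[R]_(2 + m) -> R;
  f21 : 'I_m -> 'rV[R]_(2 + m) -> R;
  f22 : 'I_m -> 'rV[R]_(2 + m) -> R;
  f23 : 'I_m -> 'rV[R]_(2 + m) -> R;
  f24 : 'I_m -> 'rV[R]_(2 + m) -> R }.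

(* a_{i,p,q,0,1} is a01 a p q, and a_{i,p,p,1,h} is a1h a p. *)
Record coeffs1 := Coeffs1 {
  a01 : 'I_m -> 'I_m -> 'rV[R]_(2 + m) -> R;
  a11 : 'I_m -> 'rV[R]_(2 + m) -> R;
  a12 : 'I_m -> 'rV[R]_(2 + m) -> R }.

Definition coeffs2_C0 (A : set 'rV[R]_(2 + m)) (f : coeffs2) : Prop :=
  (forall p q, [/\ C0_on A (f01 f p q), C0_on A (f11 f p q)
                 & C0_on A (f12 f p q)]) /\
  (forall p, [/\ C0_on A (f21 f p), C0_on A (f22 f p),
                 C0_on A (f23 f p) & C0_on A (f24 f p)]).

Definition coeffs1_C0 (A : set 'rV[R]_(2 + m)) (a : coeffs1) : Prop :=
  (forall p q, C0_on A (a01 a p q)) /\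
  (forall p, C0_on A (a11 a p) /\ C0_on A (a12 a p)).

Definition coeffs1_C1 (A : set 'rV[R]_(2 + m)) (a : coeffs1) : Prop :=
  (forall p q, C1_on A (a01 a p q)) /\
  (forall p, C1_on A (a11 a p) /\ C1_on A (a12 a p)).

(* Matrix operators: the entry (p, q) at u sends a scalar function w to a scalar
   function, the coefficients being evaluated along x |-> (x, u x) whatever w
   is. *)
Definition mxop : Type :=
  'I_m -> 'I_m -> ('rV[R]_2 -> 'rV[R]_m) -> ('rV[R]_2 -> R) -> ('rV[R]_2 -> R).

Definition mxop2 (f : coeffs2) : mxop := fun p q u w x =>
  let z := row_mx x (u x) in
  f01 f p q z * w x + f11 f p q z * partial x1 w x
    + f12 f p q z * partial x2 w x
  + (if p == q then
       f21 f p z * partial x1 (partial x1 w) x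
       + f22 f p z * partial x2 (partial x1 w) x
       + f23 f p z * partial x1 (partial x2 w) x
       + f24 f p z * partial x2 (partial x2 w) x
     else 0).

Definition mxop1 (a : coeffs1) : mxop := fun p q u w x =>
  let z := row_mx x (u x) in
  a01 a p q z * w x
  + (if p == q then
       a11 a p z * partial x1 w x + a12 a p z * partial x2 w x
     else 0).

Definition mxop_mul (S T : mxop) : mxop := fun p q u w x =>
  \sum_(l < m) S p l u (T l q u w) x.

Definition mxop_eq (Lambda : set 'rV[R]_2) (Omega : set 'rV[R]_m)
    (S T : mxop) : Prop :=
  forall (Lambda0 : set 'rV[R]_2) (u : 'rV[R]_2 -> 'rV[R]_m),
    open Lambda0 -> Lambda0 `<=` Lambda ->
    (forall q, C2_on Lambda0 (fun y => u y 0 q)) ->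
    (forall x, Lambda0 x -> Omega (u x)) ->
    forall (p q : 'I_m) (x : 'rV[R]_2), Lambda0 x ->
      S p q u (fun y => u y 0 q) x = T p q u (fun y => u y 0 q) x.

(* The operator L_p, differentiating with respect to the explicit variables
   x^1, x^2 only. *)
Definition Lop (a : coeffs1) (p : 'I_m) (b : 'rV[R]_(2 + m) -> R) :
  'rV[R]_(2 + m) -> R :=
  fun z => a11 a p z * Dx x1 b z + a12 a p z * Dx x2 b z.

Definition diagonal_conditions (f : coeffs2) (a b : coeffs1) (p : 'I_m)
    (z : 'rV[R]_(2 + m)) : Prop :=
  f01 f p p z = \sum_(l < m) a01 a p l z * a01 b l p z
                + Lop a p (a01 b p p) z /\
  f11 f p p z = a01 a p p z * a11 b p z + a11 a p z * a01 b p p z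
                + Lop a p (a11 b p) z
                + a11 a p z * Du p (a01 b p p) z * ucoord p z /\
  f12 f p p z = a01 a p p z * a12 b p z + a12 a p z * a01 b p p z
                + Lop a p (a12 b p) z
                + a12 a p z * Du p (a01 b p p) z * ucoord p z /\
  f21 f p z = a11 a p z * a11 b p z /\
  f22 f p z + f23 f p z = a12 a p z * a11 b p z + a11 a p z * a12 b p z /\
  f24 f p z = a12 a p z * a12 b p z /\
  (forall h : 'I_m, h != p -> 0 = Du h (a01 b p p) z) /\
  (forall h : 'I_m, 0 = Du h (a11 b p) z) /\
  (forall h : 'I_m, 0 = Du h (a12 b p) z).

Definition offdiagonal_conditions (f : coeffs2) (a b : coeffs1) (p q : 'I_m)
    (z : 'rV[R]_(2 + m)) : Prop :=
  f01 f p q z = \sum_(l < m) a01 a p l z * a01 b l q z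
                + Lop a p (a01 b p q) z /\
  f11 f p q z = a11 a p z * a01 b p q z + a01 a p q z * a11 b q z
                + a11 a p z * Du q (a01 b p q) z * ucoord q z /\
  f12 f p q z = a12 a p z * a01 b p q z + a01 a p q z * a12 b q z
                + a12 a p z * Du q (a01 b p q) z * ucoord q z /\
  (forall h : 'I_m, h != q -> 0 = Du h (a01 b p q) z).

Definition decomposition_conditions (A : set 'rV[R]_(2 + m)) (f : coeffs2)
    (a b : coeffs1) : Prop :=
  forall z, A z ->
    (forall p, diagonal_conditions f a b p z) /\
    (forall p q, p != q -> offdiagonal_conditions f a b p q z).

(* "Of order one" (resp. two): no diagonal entry degenerates to a lower order
   on a nonempty open part of A.  Without this the coefficient conditions are
   not necessary: for a = 0 and f = 0 the operator identity holds whatever b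
   is, even when b depends on u. *)
Definition of_order_one (A : set 'rV[R]_(2 + m)) (a : coeffs1) : Prop :=
  forall p, A `<=` closure [set z | A z /\ (a11 a p z != 0 \/ a12 a p z != 0)].

(* f22 and f23 enter through their sum only: mixed derivatives of C^2
   functions coincide. *)
Definition of_order_two (A : set 'rV[R]_(2 + m)) (f : coeffs2) : Prop :=
  forall p, A `<=` closure
    [set z | A z /\ [\/ f21 f p z != 0, f22 f p z + f23 f p z != 0
                      | f24 f p z != 0]].

End Operators.

Arguments coeffs2 : clear implicits.
Arguments coeffs1 : clear implicits.

(* Main.v *)
Require Import Defs.
From HB Require Import structures.
From mathcomp Require Import all_boot all_order all_algebra.
From mathcomp Require Import all_classical all_reals all_analysis.
From mathcomp Require Import ring lra.
Import Order.TTheory GRing.Theory Num.Theory.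
Import numFieldNormedType.Exports.
Local Open Scope classical_set_scope.
Local Open Scope ring_scope.

Set Implicit Arguments.
Unset Strict Implicit.
Unset Printing Implicit Defensive.

(** Along a C^2 function [u] the two operators are evaluated at [x] through the
    2-jet of [u] at [x] only: by the chain rule and the Leibniz rule
    ([partial_graph], [transport_graphM]) the entry (p, q) of the product is an
    explicit polynomial, of degree at most two, in the derivatives of [u] at [x],
    whose coefficients are built from the coefficients of the two factors and
    their first derivatives at the point (x, u(x)) ([mul_jet]).  Every point of
    Lambda x Omega together with every choice of first derivatives and of a
    symmetric matrix of second derivatives is the 2-jet of a quadratic polynomial
    [u], and conversely the second derivatives of a C^2 function are symmetric
    ([derive_swap]).  Hence the operator identity amounts to an identity of
    polynomials in the jet variables at each point of Lambda x Omega
    ([mxop_eq_jetP]).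

    That the conditions suffice is then a direct substitution
    ([conditions_jet]).  For the converse one compares coefficients.  This gives
    the conditions up to two kinds of factors.  First, the terms of order zero
    carry the undifferentiated unknown u^q; it vanishes on a hyperplane only, so
    it can be divided out by continuity ([divide_ucoord]).  Secondly, the
    derivatives of the coefficients of the second factor with respect to the
    unknowns come multiplied by the coefficients of L_p.  In the diagonal case
    the quadratic terms in the derivatives of u^p read
      a_1 D(b_1) = 0,   a_2 D(b_2) = 0,   a_1 D(b_2) + a_2 D(b_1) = 0
    with a_1, a_2 the coefficients of L_p, and as soon as one of a_1, a_2 is
    nonzero this triangular system forces D(b_1) = D(b_2) = 0.  Since L_p is
    nonzero on a dense set, continuity gives these conditions everywhere
    ([divide_symbol]).  Finally the second order coefficients of the product at
    a point are products with the coefficients of L_p, so that L_p is nonzero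
    wherever the operator of order two is ([jet_identity_order]). *)

(** * Symmetry of mixed directional derivatives *)

Section MixedDerivatives.
Context {R : realType} {V : normedModType R}.
Implicit Types (f : V -> R) (a v : V).

Lemma is_derive_line f a v (s : R) :
  derivable f (a + s *: v) v ->
  is_derive s 1 (fun r : R => f (a + r *: v)) ('D_v f (a + s *: v)).
Proof.
move=> df.
have E : (fun h : R => h^-1 *: (((fun r : R => f (a + r *: v)) \o shift s)
            (h *: (1 : R)) - f (a + s *: v)))
   = (fun h => h^-1 *: ((f \o shift (a + s *: v)) (h *: v) - f (a + s *: v))).
  apply/funext => h /=; congr (_ *: (f _ - _)).
  by rewrite [h *: 1]mulr1 scalerDl addrCA.
by apply: DeriveDef; rewrite /derivable /derive E.
Qed.

Lemma mean_value_line f a v (t : R) : 0 < t ->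
  (forall s, 0 <= s <= t -> derivable f (a + s *: v) v) ->
  exists2 c, 0 <= c <= t & f (a + t *: v) - f a = t * 'D_v f (a + c *: v).
Proof.
move=> t0 df.
have dline s : s \in `[0, t] ->
    is_derive s 1 (fun r : R => f (a + r *: v)) ('D_v f (a + s *: v)).
  by rewrite in_itv /= => st; apply/is_derive_line/df.
have oo_cc s : s \in `]0, t[ -> s \in `[0, t].
  by rewrite !in_itv /= => /andP[s0 st]; rewrite !ltW.
have dopen s : s \in `]0, t[ ->
    is_derive s 1 (fun r : R => f (a + r *: v)) ('D_v f (a + s *: v)).
  by move=> /oo_cc; exact: dline.
have cont : {within `[0, t], continuous (fun r : R => f (a + r *: v))}.
  by apply: derivable_within_continuous => s /dline dl; exact: ex_derive.
have [c /oo_cc] := MVT t0 dopen cont.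
rewrite in_itv /= => ct; rewrite scale0r addr0 subr0 mulrC => fE.
by exists c.
Qed.

(** The mean value theorem is used twice: along [v] for the increment
    y |-> f (y + t v') - f y, then along [v'] for the derivative of f along [v].
    The left-hand side is symmetric in [v] and [v'], the right-hand side is t^2
    times one mixed derivative near [a]. *)
Lemma second_difference f a v v' (t : R) : 0 < t ->
  (forall s s', 0 <= s <= t -> 0 <= s' <= t ->
     derivable f (a + s *: v + s' *: v') v /\
     derivable ('D_v f) (a + s *: v + s' *: v') v') ->
  exists c c', [/\ 0 <= c <= t, 0 <= c' <= t &
    f (a + t *: v + t *: v') - f (a + t *: v) - f (a + t *: v') + f a
      = t * (t * 'D_v' ('D_v f) (a + c *: v + c' *: v'))].
Proof.
move=> t0 df.
have tt : 0 <= t <= t by rewrite lexx ltW.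
have z0 : (0 : R) <= 0 <= t by rewrite lexx ltW.
pose g y := f (y + t *: v') - f y.
have dg s : 0 <= s <= t -> is_derive (a + s *: v) v g
    ('D_v f (a + s *: v + t *: v') - 'D_v f (a + s *: v)).
  move=> st; have [d1 _] := df s t st tt.
  have d0 : derivable f (a + s *: v) v.
    by have [] := df s 0 st z0; rewrite scale0r addr0.
  have E : (fun h : R => h^-1 *: (((fun y => f (y + t *: v')) \o
               shift (a + s *: v)) (h *: v) - f (a + s *: v + t *: v')))
    = (fun h => h^-1 *: ((f \o shift (a + s *: v + t *: v')) (h *: v)
               - f (a + s *: v + t *: v'))).
    by apply/funext => h /=; rewrite -!addrA.
  have d1' : is_derive (a + s *: v) v (fun y => f (y + t *: v'))
      ('D_v f (a + s *: v + t *: v')).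
    apply: DeriveDef; first exact: (eq_ind_r (fun F => cvg (F @ 0^')) d1 E).
    exact: (congr1 (fun F => lim (F @ 0^')) E).
  exact: is_deriveB d1' (derivableP d0).
have [|c ct gE] := @mean_value_line g a v t t0.
  by move=> s /dg dgs; exact: ex_derive.
have [|c' c't dE] := @mean_value_line ('D_v f) (a + c *: v) v' t t0.
  by move=> s st; have [] := df c s ct st.
exists c, c'; split => //.
rewrite -dE; have /dg/(@derive_val _ _ _ _ _ _ _) <- := ct.
by rewrite -gE /g [a + t *: v' ]addrC; ring.
Qed.

(** Schwarz's theorem.  The symmetric second difference is t^2 times either
    mixed derivative, each taken at some point close to [a]; if the mixed
    derivatives differed at [a], continuity would keep them apart at these
    points as well. *)
Lemma derive_swap f a v v' :
  (\forall y \near a, [/\ derivable f y v, derivable f y v',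
      derivable ('D_v f) y v' & derivable ('D_v' f) y v]) ->
  {for a, continuous ('D_v' ('D_v f))} ->
  {for a, continuous ('D_v ('D_v' f))} ->
  'D_v' ('D_v f) a = 'D_v ('D_v' f) a.
Proof.
move=> df c1 c2; apply/eqP/negPn/negP => ne.
set d1 := 'D_v' ('D_v f) a in ne *; set d2 := 'D_v ('D_v' f) a in ne *.
have e0 : 0 < `|d1 - d2| / 2 by rewrite divr_gt0 // normr_gt0 subr_eq0.
have n1 : \forall y \near a, `|d1 - 'D_v' ('D_v f) y| < `|d1 - d2| / 2.
  by move/cvgrPdist_lt: c1 => /(_ _ e0).
have n2 : \forall y \near a, `|d2 - 'D_v ('D_v' f) y| < `|d1 - d2| / 2.
  by move/cvgrPdist_lt: c2 => /(_ _ e0).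
have H := filterI df (filterI n1 n2).
have [r /= r0 Hr] := iffLR (nbhs_normP _ _) (H _ _).
set N := `|v| + `|v'| + 1.
have N0 : 0 < N by rewrite /N ltr_wpDl ?addr_ge0.
(* With this step the parallelogram of sides t v, t v' stays within r of a. *)
pose t := r / N / 2.
have t0 : 0 < t by rewrite !divr_gt0.
have near_a s s' : 0 <= s <= t -> 0 <= s' <= t ->
    ball_ Num.norm a r (a + s *: v + s' *: v').
  move=> /andP[s0 st] /andP[s0' st'] /=.
  rewrite -addrA opprD addrA subrr sub0r normrN.
  apply: (le_lt_trans (ler_normD _ _)); rewrite !normrZ !ger0_norm //.
  apply: (@le_lt_trans _ _ (t * N)); last first.
    rewrite /t mulrAC divfK ?gt_eqF //.
    by rewrite ltr_pdivrMr // ltr_pMr // ltr1n.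
  rewrite /N !mulrDr -[leLHS]addr0; apply: lerD; last by rewrite mulr1 ltW.
  by apply: lerD; apply: ler_wpM2r.
have [|c [c' [ct ct' E1]]] := @second_difference f a v v' t t0.
  by move=> s s' st st'; have [[h1 _ h3 _] _] := Hr _ (near_a _ _ st st'); split.
have [|k [k' [kt kt' E2]]] := @second_difference f a v' v t t0.
  move=> s s' st st'; have [[_ h2 _ h4] _] := Hr _ (near_a _ _ st' st).
  by rewrite [a + s *: v' + s' *: v]addrAC; split.
have [_ [B1 _]] := Hr _ (near_a _ _ ct ct').
have [_ [_ B2]] := Hr _ (near_a _ _ kt' kt).
rewrite [a + k' *: v + _]addrAC in B2; rewrite [a + t *: v' + _]addrAC in E2.
move: ('D_v' ('D_v f) _) ('D_v ('D_v' f) _) E1 E2 B1 B2 => X Y E1 E2 B1 B2.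
have XY : X = Y.
  apply: (mulfI (lt0r_neq0 t0)); apply: (mulfI (lt0r_neq0 t0)).
  by rewrite -E1 -E2; congr (_ + _); exact: addrAC.
rewrite -XY in B2; have := ler_normB (d1 - X) (d2 - X).
rewrite opprB addrA subrK => /le_lt_trans /(_ (ltrD B1 B2)).
by rewrite -splitr ltxx.
Qed.

End MixedDerivatives.

(** * Total derivatives along a graph *)

Section Graph.
Context {R : realType}.

(** A row is the sum of its coordinates times fixed basis vectors. *)
Lemma differentiable_row (V : normedModType R) n (F : V -> 'rV[R]_n) (x : V) :
  (forall j, differentiable (fun y => F y 0 j) x) -> differentiable F x.
Proof.
move=> dF; have -> : F = \sum_j (fun y => F y 0 j *: delta_mx 0 j).
  by apply/funext => y; rewrite fct_sumE {1}[F y]row_sum_delta.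
by apply: differentiable_sum => j; exact: differentiableZl.
Qed.

Lemma derive_coord n (j : 'I_n) (x v : 'rV[R]_n) :
  'D_v (fun y : 'rV[R]_n => y 0 j) x = v 0 j.
Proof.
have E := derive_mx (@derivable_id _ _ x v).
by have := derive_id x v; rewrite E => /rowP/(_ j); rewrite mxE.
Qed.

Context {m : nat}.
Implicit Types (u : 'rV[R]_2 -> 'rV[R]_m) (b : 'rV[R]_(2 + m) -> R).

Definition graph u (y : 'rV[R]_2) : 'rV[R]_(2 + m) := row_mx y (u y).

Lemma graph_indep u k :
  (fun y => graph u y 0 (lshift m k)) = fun y => y 0 k.
Proof. by apply/funext => y; rewrite /graph row_mxEl. Qed.

Lemma graph_dep u k :
  (fun y => graph u y 0 (rshift 2 k)) = fun y => u y 0 k.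
Proof. by apply/funext => y; rewrite /graph row_mxEr. Qed.

Definition partials (i : 'I_2) u (x : 'rV[R]_2) : 'I_m -> R :=
  fun h => partial i (fun y => u y 0 h) x.

Lemma differentiable_graph u x :
  (forall q, differentiable (fun y => u y 0 q) x) -> differentiable (graph u) x.
Proof.
move=> du; apply: differentiable_row => j; rewrite -[j]splitK.
case: (fintype.split j) => k /=; last by rewrite graph_dep.
by rewrite graph_indep; exact: differentiable_coord.
Qed.

(** The chain rule: the derivative of the graph in the direction x^i has
    coordinates delta_(i,j) on the independent variables and the derivatives of
    u^h on the others. *)
Lemma partial_graph u b x i :
  (forall q, differentiable (fun y => u y 0 q) x) ->
  differentiable b (graph u x) ->
  partial i (fun y => b (graph u y)) x =
  Dx i b (graph u x) +
  \sum_h Du h b (graph u x) * partials i u x h.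
Proof.
move=> du db; have dg := differentiable_graph du.
have dbg : differentiable (b \o graph u) x by exact: differentiable_comp.
rewrite /partial (deriveE _ dbg) diff_comp //= -(deriveE _ dg).
rewrite derive_mx; last exact: diff_derivable.
rewrite {1}[\matrix_(_, _) _]row_sum_delta linear_sum big_split_ord /=.
congr (_ + _).
- rewrite (bigD1 i) //= big1 ?addr0 => [|j ji];
    rewrite linearZ /= mxE graph_indep derive_coord mxE eqxx /=.
    by rewrite eqxx scale1r /Dx /partial deriveE.
  by rewrite (negPf ji) scale0r.
- apply: eq_bigr => h _; rewrite linearZ /= mxE graph_dep [RHS]mulrC.
  by rewrite /Du /partials /partial (deriveE _ db).
Qed.

Lemma differentiable_along_graph u b x :
  (forall q, differentiable (fun y => u y 0 q) x) ->
  differentiable b (graph u x) -> differentiable (fun y => b (graph u y)) x.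
Proof.
move=> du db; apply: (@differentiable_comp _ _ _ _ (graph u) b) => //.
exact: differentiable_graph.
Qed.

Lemma partialD n (g1 g2 : 'rV[R]_n -> R) i x :
  differentiable g1 x -> differentiable g2 x ->
  partial i (fun y => g1 y + g2 y) x = partial i g1 x + partial i g2 x.
Proof. by move=> d1 d2; rewrite /partial -deriveD //; exact: diff_derivable. Qed.

Lemma partialM n (g1 g2 : 'rV[R]_n -> R) i x :
  differentiable g1 x -> differentiable g2 x ->
  partial i (fun y => g1 y * g2 y) x =
  g1 x * partial i g2 x + g2 x * partial i g1 x.
Proof. by move=> d1 d2; rewrite /partial -deriveM //; exact: diff_derivable. Qed.

(** The constants [c1], [c2] stand for the coefficients of a first order operator
    frozen at [x]; grouping the derivatives of each u^h as
    c1 (u^h)_(x^1) + c2 (u^h)_(x^2) is what later lets one compare coefficients. *)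
Lemma transport_graphM u b v (x : 'rV[R]_2) (c1 c2 : R) :
  (forall q, differentiable (fun y => u y 0 q) x) ->
  differentiable b (graph u x) -> differentiable v x ->
  let g := fun y => b (graph u y) * v y in
  c1 * partial x1 g x + c2 * partial x2 g x =
  (c1 * Dx x1 b (graph u x) + c2 * Dx x2 b (graph u x) +
   \sum_h Du h b (graph u x) * (c1 * partials x1 u x h + c2 * partials x2 u x h)) * v x +
  b (graph u x) * (c1 * partial x1 v x + c2 * partial x2 v x).
Proof.
move=> du db dv g; have dbu := differentiable_along_graph du db.
rewrite /g !partialM // !partial_graph //.
have -> : \sum_h Du h b (graph u x) * (c1 * partials x1 u x h + c2 * partials x2 u x h) =
    c1 * (\sum_h Du h b (graph u x) * partials x1 u x h) +
    c2 * (\sum_h Du h b (graph u x) * partials x2 u x h).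
  rewrite !mulr_sumr -big_split; apply: eq_bigr => h _ /=.
  by move: (Du h b _) (partials _ _ _ _) (partials _ _ _ _) => *; ring.
move: (\sum_h Du h b (graph u x) * partials x1 u x h).
move: (\sum_h Du h b (graph u x) * partials x2 u x h).
move: (b _) (Dx _ _ _) (Dx _ _ _) (partial x1 v x) (partial x2 v x) (v x).
by move=> *; ring.
Qed.

End Graph.

(** * The operators on the level of 2-jets *)

Section Jets.
Context {R : realType} {m : nat}.
Implicit Types (f : coeffs2 R m) (a b : coeffs1 R m) (z : 'rV[R]_(2 + m)).

(** The value of the entry (p, q) of the operator of order two on a function u
    with u(x) given by [z], first derivatives [d1 h], [d2 h] of u^h, and second
    derivatives [wij] of u^q; [w21] is the derivative with respect to x^1 first,
    then x^2. *)
Definition jet_mxop2 f p q z (d1 d2 : 'I_m -> R) (w11 w21 w12 w22 : R) : R :=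
  f01 f p q z * ucoord q z + f11 f p q z * d1 q + f12 f p q z * d2 q
  + (if p == q then
       f21 f p z * w11 + f22 f p z * w21 + f23 f p z * w12 + f24 f p z * w22
     else 0).

(** The same for the product of two operators of order one; [L h] is the
    value of a11 D_(1,1) + a12 D_(1,2), the first order part of the left
    factor, at u^h. *)
Definition jet_mul a b p q z (d1 d2 : 'I_m -> R) (w11 w21 w12 w22 : R) : R :=
  let L h := a11 a p z * d1 h + a12 a p z * d2 h in
  (\sum_(l < m) a01 a p l z * a01 b l q z + Lop a p (a01 b p q) z
     + \sum_h Du h (a01 b p q) z * L h) * ucoord q z
  + a01 a p q z * (a11 b q z * d1 q + a12 b q z * d2 q) + a01 b p q z * L q
  + (if p == q then
       (Lop a p (a11 b q) z + \sum_h Du h (a11 b q) z * L h) * d1 q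
       + (Lop a p (a12 b q) z + \sum_h Du h (a12 b q) z * L h) * d2 q
       + a11 b q z * (a11 a p z * w11 + a12 a p z * w21)
       + a12 b q z * (a11 a p z * w12 + a12 a p z * w22)
     else 0).

(** The mixed derivatives are identified here, as they are for C^2 functions. *)
Definition jet_identity f a b z : Prop :=
  forall p q d1 d2 w11 w12 w22,
    jet_mxop2 f p q z d1 d2 w11 w12 w12 w22 =
    jet_mul a b p q z d1 d2 w11 w12 w12 w22.

Lemma ucoord_graph (u : 'rV[R]_2 -> 'rV[R]_m) q x :
  ucoord q (graph u x) = u x 0 q.
Proof. by rewrite /ucoord /graph row_mxEr. Qed.

Lemma mxop2_jet f p q (u : 'rV[R]_2 -> 'rV[R]_m) x :
  let w y := u y 0 q in
  mxop2 f p q u w x =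
  jet_mxop2 f p q (graph u x)
    (partials x1 u x) (partials x2 u x)
    (partial x1 (partial x1 w) x) (partial x2 (partial x1 w) x)
    (partial x1 (partial x2 w) x) (partial x2 (partial x2 w) x).
Proof. by rewrite /mxop2 /jet_mxop2 ucoord_graph. Qed.

Lemma mxop1_mul_left a (T : mxop (R := R) (m := m)) p q u w x :
  mxop_mul (mxop1 a) T p q u w x =
  \sum_l a01 a p l (graph u x) * T l q u w x
  + (a11 a p (graph u x) * partial x1 (T p q u w) x
     + a12 a p (graph u x) * partial x2 (T p q u w) x).
Proof.
rewrite /mxop_mul /mxop1 big_split /=; congr (_ + _).
by rewrite -big_mkcond /= (eq_bigl (pred1 p)) ?big_pred1_eq // => l; rewrite eq_sym.
Qed.

(** The part of order zero of the left factor contributes the sum over all l;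
    its derivatives, present on the diagonal only, act by the Leibniz rule on
    each summand of the entry (p, q) of the right factor. *)
Lemma mul_jet a b p q (u : 'rV[R]_2 -> 'rV[R]_m) x :
  (forall h, differentiable (fun y => u y 0 h) x) ->
  (forall i, differentiable (partial i (fun y => u y 0 q)) x) ->
  differentiable (a01 b p q) (graph u x) ->
  differentiable (a11 b q) (graph u x) ->
  differentiable (a12 b q) (graph u x) ->
  let w y := u y 0 q in
  mxop_mul (mxop1 a) (mxop1 b) p q u w x =
  jet_mul a b p q (graph u x)
    (partials x1 u x) (partials x2 u x)
    (partial x1 (partial x1 w) x) (partial x2 (partial x1 w) x)
    (partial x1 (partial x2 w) x) (partial x2 (partial x2 w) x).
Proof.
move=> du ddu d01 d11 d12 w; rewrite mxop1_mul_left.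
have low : \sum_l a01 a p l (graph u x) * mxop1 b l q u w x =
    (\sum_l a01 a p l (graph u x) * a01 b l q (graph u x)) * w x
    + a01 a p q (graph u x) * (a11 b q (graph u x) * partial x1 w x
                               + a12 b q (graph u x) * partial x2 w x).
  under eq_bigr => l _ do rewrite /mxop1 mulrDr mulrA.
  rewrite big_split /= mulr_suml; congr (_ + _).
  rewrite (bigD1 q) //= eqxx big1 ?addr0 // => l /negPf ->; exact: mulr0.
set c1 := a11 a p (graph u x); set c2 := a12 a p (graph u x).
pose g0 y := a01 b p q (graph u y) * w y.
pose g1 y := a11 b q (graph u y) * partial x1 w y.
pose g2 y := a12 b q (graph u y) * partial x2 w y.
have T0 : c1 * partial x1 g0 x + c2 * partial x2 g0 x = _ :=
  transport_graphM (v := w) c1 c2 du d01 (du q).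
have T1 : c1 * partial x1 g1 x + c2 * partial x2 g1 x = _ :=
  transport_graphM (v := partial x1 w) c1 c2 du d11 (ddu x1).
have T2 : c1 * partial x1 g2 x + c2 * partial x2 g2 x = _ :=
  transport_graphM (v := partial x2 w) c1 c2 du d12 (ddu x2).
have D0 : differentiable g0 x.
  exact: differentiableM (differentiable_along_graph du d01) (du q).
have D1 : differentiable g1 x.
  exact: differentiableM (differentiable_along_graph du d11) (ddu x1).
have D2 : differentiable g2 x.
  exact: differentiableM (differentiable_along_graph du d12) (ddu x2).
have D12 : differentiable (fun y => g1 y + g2 y) x by exact: differentiableD.
have entryE : mxop1 b p q u w =
    if p == q then fun y => g0 y + (g1 y + g2 y) else g0.
  apply/funext => y; rewrite /mxop1 /g0.
  by have [->//|_] := eqVneq p q; rewrite addr0.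
rewrite low entryE /jet_mul ucoord_graph -/(w x) /Lop -/c1 -/c2.
rewrite -[partials x1 u x q]/(partial x1 w x) -[partials x2 u x q]/(partial x2 w x).
(* The coefficients of the left factor are only evaluated at x, so they may be
   treated as constants from here on. *)
clearbody g0 g1 g2 c1 c2 w; clear low entryE du ddu d01 d11 d12.
have [_|_] := eqVneq p q; last first.
  rewrite {}T0; move: (\sum_h Du h (a01 b p q) _ * _) (\sum_l _) (w x).
  move: (partial x1 w x) (partial x2 w x).
  move: (Dx _ _ _) (Dx _ _ _) (a01 _ _ _ _) (a01 _ _ _ _).
  by move: (a11 _ _ _) (a12 _ _ _) => *; ring.
rewrite !(partialD _ D0 D12) !(partialD _ D1 D2) {D0 D1 D2 D12}.
move: (partial x1 g0 x) (partial x2 g0 x) T0 => r1 r2 T0.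
move: (partial x1 g1 x) (partial x2 g1 x) T1 => s1 s2 T1.
move: (partial x1 g2 x) (partial x2 g2 x) T2 => t1 t2 T2.
have -> : c1 * (r1 + (s1 + t1)) + c2 * (r2 + (s2 + t2)) =
    (c1 * r1 + c2 * r2) + (c1 * s1 + c2 * s2) + (c1 * t1 + c2 * t2) by ring.
rewrite {}T0 {}T1 {}T2.
move: (\sum_h Du h (a01 b p q) _ * _) (\sum_h Du h (a11 b q) _ * _).
move: (\sum_h Du h (a12 b q) _ * _) (\sum_l _) (w x).
move: (partial x1 (partial x1 w) x) (partial x2 (partial x1 w) x).
move: (partial x1 (partial x2 w) x) (partial x2 (partial x2 w) x).
move: (partial x1 w x) (partial x2 w x) (a01 _ _ _ _) (a01 _ _ _ _).
move: (a11 b q _) (a12 b q _).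
do 6![move: (Dx _ _ _)].
by move=> *; ring.
Qed.

End Jets.

(** * The operator identity as an identity of jets *)

Section JetIdentity.
Context {R : realType} {m : nat}.
Implicit Types (f : coeffs2 R m) (a b : coeffs1 R m) (z : 'rV[R]_(2 + m)).

Lemma C2_partial_swap n (A : set 'rV[R]_n) (w : 'rV[R]_n -> R) i j x :
  open A -> C2_on A w -> A x ->
  partial i (partial j w) x = partial j (partial i w) x.
Proof.
move=> oA [[dw cw] ddw] Ax; apply: derive_swap.
- have : \forall y \near x, A y by exact: open_nbhs_nbhs.
  apply: filterS => y Ay; split; apply: diff_derivable.
  + exact: dw.
  + exact: dw.
  + exact: (ddw j).1.
  + exact: (ddw i).1.
- exact: ((ddw j).2 i x Ax).
- exact: ((ddw i).2 j x Ax).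
Qed.

Lemma C2_differentiable n (A : set 'rV[R]_n) (w : 'rV[R]_n -> R) x :
  C2_on A w -> A x ->
  differentiable w x /\ (forall i, differentiable (partial i w) x).
Proof. by move=> [[dw _] ddw] Ax; split=> [|i]; [exact: dw|exact: (ddw i).1]. Qed.

Definition offset (x0 : 'rV[R]_2) (i : 'I_2) : 'rV[R]_2 -> R :=
  fun y => y 0 i - x0 0 i.

(** The quadratic polynomial with prescribed 2-jet at [x0]; the family is closed
    under partial derivatives, so that all derivatives needed are read off at
    the centre. *)
Definition taylor2 (x0 : 'rV[R]_2) (c d1 d2 e11 e12 e22 : R) : 'rV[R]_2 -> R :=
  cst c + d1 *: offset x0 x1 + d2 *: offset x0 x2
  + (e11 / 2) *: (offset x0 x1 * offset x0 x1)
  + e12 *: (offset x0 x1 * offset x0 x2)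
  + (e22 / 2) *: (offset x0 x2 * offset x0 x2).

Lemma differentiable_offset x0 i y : differentiable (offset x0 i) y.
Proof.
apply: (@differentiableB _ _ _ (fun y : 'rV[R]_2 => y 0 i) (cst (x0 0 i))) => //.
exact: differentiable_coord.
Qed.

Lemma partial_offset x0 i j y : partial j (offset x0 i) y = (i == j)%:R.
Proof.
rewrite /partial (@deriveB _ _ _ (fun y : 'rV_2 => y 0 i) (cst (x0 0 i))) //.
  by rewrite derive_coord derive_cst subr0 mxE eqxx.
exact/diff_derivable/differentiable_coord.
Qed.

Lemma differentiable_taylor2 x0 c d1 d2 e11 e12 e22 y :
  differentiable (taylor2 x0 c d1 d2 e11 e12 e22) y.
Proof.
have d i := differentiable_offset x0 i y.
have dM i j : differentiable (offset x0 i * offset x0 j) y.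
  exact: differentiableM.
rewrite /taylor2; do 5![apply: differentiableD; last exact: differentiableZ].
exact: differentiable_cst.
Qed.

Lemma partial_taylor2 x0 c d1 d2 e11 e12 e22 i :
  partial i (taylor2 x0 c d1 d2 e11 e12 e22) =
  taylor2 x0 (if i == x1 then d1 else d2)
    (if i == x1 then e11 else e12) (if i == x1 then e12 else e22) 0 0 0.
Proof.
apply/funext => y.
have ds k : is_derive y (delta_mx 0 i) (offset x0 k) (k == i)%:R.
  rewrite -(partial_offset x0 k i y); apply: derivableP.
  exact/diff_derivable/differentiable_offset.
have D := is_deriveD (is_deriveD (is_deriveD (is_deriveD (is_deriveD
  (is_derive_cst c y (delta_mx 0 i)) (is_deriveZ d1 (ds x1)))
  (is_deriveZ d2 (ds x2))) (is_deriveZ (e11 / 2) (is_deriveM (ds x1) (ds x1))))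
  (is_deriveZ e12 (is_deriveM (ds x1) (ds x2))))
  (is_deriveZ (e22 / 2) (is_deriveM (ds x2) (ds x2))).
rewrite -/(taylor2 x0 c d1 d2 e11 e12 e22) in D.
rewrite /partial (@derive_val _ _ _ _ _ _ _ D) /taylor2 !fctE.
rewrite /GRing.scale /=; move: (offset x0 x1 y) (offset x0 x2 y) => s1 s2.
have [->|i0] := eqVneq i x1; rewrite ?eqxx /=.
  by rewrite /x1 /x2 /=; field.
have -> : i = x2 by apply/val_inj; case: i i0 {ds D} => -[|[|]].
by rewrite eqxx /=; field.
Qed.

Lemma taylor2_center x0 c d1 d2 e11 e12 e22 :
  taylor2 x0 c d1 d2 e11 e12 e22 x0 = c.
Proof.
by rewrite /taylor2 !fctE /offset !subrr !mulr0 !scaler0 !addr0.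
Qed.

Lemma taylor2_C2 A x0 c d1 d2 e11 e12 e22 :
  C2_on A (taylor2 x0 c d1 d2 e11 e12 e22).
Proof.
have C1 c' d1' d2' e11' e12' e22' :
    C1_on A (taylor2 x0 c' d1' d2' e11' e12' e22').
  split=> [z _|i z _]; first exact: differentiable_taylor2.
  rewrite partial_taylor2.
  exact/differentiable_continuous/differentiable_taylor2.
by split=> // i; rewrite partial_taylor2.
Qed.

(** From left to right, the quadratic polynomials realize all symmetric 2-jets
    over all points; the admissible domain is the part of Lambda that such a
    polynomial maps into Omega.  From right to left, 2-jets of C^2 functions are
    symmetric. *)
Lemma mxop_eq_jetP (Lambda : set 'rV[R]_2) (Omega : set 'rV[R]_m) f a b :
  open Lambda -> open Omega -> coeffs1_C1 (prod_dom Lambda Omega) b ->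
  mxop_eq Lambda Omega (mxop2 f) (mxop_mul (mxop1 a) (mxop1 b)) <->
  forall z, prod_dom Lambda Omega z -> jet_identity f a b z.
Proof.
move=> oL oO [b01 b1].
have jets (u : 'rV[R]_2 -> 'rV[R]_m) p q x :
    prod_dom Lambda Omega (graph u x) ->
    (forall h, differentiable (fun y => u y 0 h) x) ->
    (forall i, differentiable (partial i (fun y => u y 0 q)) x) ->
    mxop_mul (mxop1 a) (mxop1 b) p q u (fun y => u y 0 q) x = _ :=
  fun Az du ddu => mul_jet a du ddu ((b01 p q).1 _ Az)
    ((b1 q).1.1 _ Az) ((b1 q).2.1 _ Az).
split=> [eqfab z Az p q d1 d2 w11 w12 w22|eqjet Lambda0 u oL0 L0L C2u uO p q x L0x].
- pose w h := taylor2 (lsubmx z) (rsubmx z 0 h) (d1 h) (d2 h) w11 w12 w22.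
  pose u y : 'rV[R]_m := \row_h w h y.
  have uE h : (fun y => u y 0 h) = w h by apply/funext => y; rewrite mxE.
  have du y h : differentiable (fun y => u y 0 h) y.
    by rewrite uE; exact: differentiable_taylor2.
  have uz : graph u (lsubmx z) = z.
    rewrite /graph -[RHS]hsubmxK; congr row_mx.
    by apply/rowP => h; rewrite mxE /w taylor2_center.
  have oL0 : open (Lambda `&` u @^-1` Omega).
    apply: openI => //; apply: open_comp => // y _.
    exact/differentiable_continuous/differentiable_row.
  have := eqfab _ u oL0 (@subIsetl _ _ _) _ _ p q (lsubmx z).
  rewrite mxop2_jet jets ?uz //; last first.
    by move=> i; rewrite uE /w partial_taylor2; exact: differentiable_taylor2.
  have -> : partials x1 u (lsubmx z) = d1.
    by apply/funext => h; rewrite /partials uE /w partial_taylor2 taylor2_center.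
  have -> : partials x2 u (lsubmx z) = d2.
    by apply/funext => h; rewrite /partials uE /w partial_taylor2 taylor2_center.
  rewrite uE /w !partial_taylor2 !taylor2_center /=; apply.
  + by move=> h; rewrite uE; exact: taylor2_C2.
  + by move=> y [].
  + split; first exact: Az.1.
    have -> : u (lsubmx z) = rsubmx z by rewrite -uz /graph row_mxKl row_mxKr.
    exact: Az.2.
- have [_ ddu] := C2_differentiable (C2u q) L0x.
  have Az : prod_dom Lambda Omega (graph u x).
    by rewrite /prod_dom /graph /= row_mxKl row_mxKr; split; [exact: L0L|exact: uO].
  rewrite mxop2_jet jets //; last by move=> h; exact: (C2_differentiable (C2u h) L0x).1.
  by rewrite (C2_partial_swap x2 x1 oL0 (C2u q) L0x); exact: eqjet.
Qed.

End JetIdentity.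

(** * Comparison of coefficients at a point *)

Section Coefficients.
Context {R : realType} {m : nat}.
Implicit Types (f : coeffs2 R m) (a b : coeffs1 R m) (z : 'rV[R]_(2 + m)).

Lemma sum_supp1 (D L : 'I_m -> R) q :
  (forall h, h != q -> D h = 0) -> \sum_h D h * L h = D q * L q.
Proof.
move=> D0; rewrite (bigD1 q) //= big1 ?addr0 // => h /D0 ->; exact: mul0r.
Qed.

(** The conditions on the derivatives with respect to the unknowns remove all
    quadratic terms and leave the single term h = q in the remaining sum. *)
Lemma conditions_jet f a b z :
  (forall p, diagonal_conditions f a b p z) ->
  (forall p q, p != q -> offdiagonal_conditions f a b p q z) ->
  jet_identity f a b z.
Proof.
move=> diag off p q d1 d2 w11 w12 w22; rewrite /jet_mxop2 /jet_mul /=.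
have [<-|pq] := eqVneq p q; last first.
  have [-> [-> [-> D0]]] := off p q pq.
  rewrite (@sum_supp1 (fun h => Du h (a01 b p q) z) _ q) => [|h /D0 //].
  set S := \sum_l _; move: S (Lop _ _ _ _) => S L.
  by move: (ucoord _ _) (d1 q) (d2 q) => w e1 e2; ring.
have [-> [-> [-> [-> [f2223 [-> [D0 [D1 D2]]]]]]]] := diag p.
rewrite (@sum_supp1 (fun h => Du h (a01 b p p) z) _ p) => [|h /D0 //].
rewrite [\sum_h Du h (a11 b p) z * _]big1 => [|h _]; last by rewrite -D1 mul0r.
rewrite [\sum_h Du h (a12 b p) z * _]big1 => [|h _]; last by rewrite -D2 mul0r.
have -> : f22 f p z = a12 a p z * a11 b p z + a11 a p z * a12 b p z - f23 f p z.
  by rewrite -f2223 addrK.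
set S := \sum_l _; move: S (Lop _ _ _ _) (Lop _ _ _ _) (Lop _ _ _ _).
by move: (ucoord _ _) (d1 p) (d2 p) => *; ring.
Qed.

(** First derivatives concentrated on the unknowns [h] and [q]: enough to
    separate the monomials of degree at most two that occur. *)
Definition two_delta (h q : 'I_m) (s s' : R) : 'I_m -> R :=
  fun k => (k == h)%:R * s + (k == q)%:R * s'.

Lemma two_delta_same q s s' : two_delta q q s s' q = s + s'.
Proof. by rewrite /two_delta eqxx !mul1r. Qed.

Lemma two_delta_other h q s s' : h != q -> two_delta h q s s' q = s'.
Proof. by rewrite /two_delta eqxx eq_sym mul1r => /negPf ->; rewrite mul0r add0r. Qed.

Lemma sum_two_delta (D : 'I_m -> R) h q (c1 c2 s t s' t' : R) :
  \sum_k D k * (c1 * two_delta h q s s' k + c2 * two_delta h q t t' k) =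
  D h * (c1 * s + c2 * t) + D q * (c1 * s' + c2 * t').
Proof.
have pick r (X : R) : \sum_k D k * ((k == r)%:R * X) = D r * X.
  rewrite (bigD1 r) //= eqxx mul1r big1 ?addr0 // => k /negPf ->.
  by rewrite mul0r mulr0.
rewrite -!pick -big_split; apply: eq_bigr => k _.
by rewrite /two_delta /=; ring.
Qed.

(** The next four lemmas are comparisons of coefficients in polynomial
    identities; the variables stand for the values at one point of the
    coefficients and of their derivatives. *)
Lemma off_identity (f0 f1 f2 w e0 k b1 b2 b0 c1 c2 D : R) :
  (forall s t, f0 * w + f1 * s + f2 * t =
     (e0 + D * (c1 * s + c2 * t)) * w + k * (b1 * s + b2 * t)
     + b0 * (c1 * s + c2 * t)) ->
  [/\ (f0 - e0) * w = 0, f1 = c1 * b0 + k * b1 + c1 * D * w &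
      f2 = c2 * b0 + k * b2 + c2 * D * w].
Proof.
move=> E; have E0 := E 0 0; have E1 := E 1 0; have E2 := E 0 1.
by split; lra.
Qed.

Lemma off_identity_other (f0 w e0 c1 c2 D : R) :
  (forall s t, f0 * w = (e0 + D * (c1 * s + c2 * t)) * w) ->
  c1 * D * w = 0 /\ c2 * D * w = 0.
Proof.
move=> E; have E0 := E 0 0; have E1 := E 1 0; have E2 := E 0 1.
by split; lra.
Qed.

Lemma diag_identity
    (f0 f1 f2 g11 g12 g21 g22 w e0 k b1 b2 b0 c1 c2 D l1 l2 D1 D2 : R) :
  (forall s t w11 w12 w22,
     f0 * w + f1 * s + f2 * t + (g11 * w11 + g12 * w12 + g21 * w12 + g22 * w22) =
     (e0 + D * (c1 * s + c2 * t)) * w + k * (b1 * s + b2 * t)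
     + b0 * (c1 * s + c2 * t)
     + ((l1 + D1 * (c1 * s + c2 * t)) * s + (l2 + D2 * (c1 * s + c2 * t)) * t
        + b1 * (c1 * w11 + c2 * w12) + b2 * (c1 * w12 + c2 * w22))) ->
  [/\ (f0 - e0) * w = 0,
      f1 = k * b1 + c1 * b0 + l1 + c1 * D * w,
      f2 = k * b2 + c2 * b0 + l2 + c2 * D * w,
      [/\ g11 = c1 * b1, g12 + g21 = c2 * b1 + c1 * b2 & g22 = c2 * b2] &
      [/\ c1 * D1 = 0, c2 * D2 = 0 & c1 * D2 + c2 * D1 = 0]].
Proof.
move=> E; have E0 := E 0 0 0 0 0.
have Es := E 1 0 0 0 0; have Es' := E (-1) 0 0 0 0.
have Et := E 0 1 0 0 0; have Et' := E 0 (-1) 0 0 0.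
have Est := E 1 1 0 0 0.
have Ew11 := E 0 0 1 0 0; have Ew12 := E 0 0 0 1 0; have Ew22 := E 0 0 0 0 1.
by clear E; split; [| | |split|split]; lra.
Qed.

Lemma diag_identity_other
    (f0 f1 f2 w e0 k b1 b2 b0 c1 c2 D l1 l2 D1 D2 Dh D1h D2h : R) :
  (forall s t s' t',
     f0 * w + f1 * s' + f2 * t' =
     (e0 + (Dh * (c1 * s + c2 * t) + D * (c1 * s' + c2 * t'))) * w
     + k * (b1 * s' + b2 * t') + b0 * (c1 * s' + c2 * t')
     + ((l1 + (D1h * (c1 * s + c2 * t) + D1 * (c1 * s' + c2 * t'))) * s'
      + (l2 + (D2h * (c1 * s + c2 * t) + D2 * (c1 * s' + c2 * t'))) * t')) ->
  [/\ c1 * Dh * w = 0, c2 * Dh * w = 0,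
      c1 * D1h = 0 /\ c2 * D1h = 0 & c1 * D2h = 0 /\ c2 * D2h = 0].
Proof.
move=> E; have E0 := E 0 0 0 0; have E1 := E 1 0 0 0; have E2 := E 0 1 0 0.
have F0 := E 0 0 1 0; have F1 := E 1 0 1 0; have F2 := E 0 1 1 0.
have G0 := E 0 0 0 1; have G1 := E 1 0 0 1; have G2 := E 0 1 0 1.
by clear E; split; [| |split|split]; lra.
Qed.

(** Jets on which only u^q varies give the three equations, jets on which only
    another u^h varies give the last condition. *)
Lemma jet_identity_off f a b z p q : jet_identity f a b z -> p != q ->
  [/\ (f01 f p q z - (\sum_(l < m) a01 a p l z * a01 b l q z
                      + Lop a p (a01 b p q) z)) * ucoord q z = 0,
      f11 f p q z = a11 a p z * a01 b p q z + a01 a p q z * a11 b q z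
                    + a11 a p z * Du q (a01 b p q) z * ucoord q z,
      f12 f p q z = a12 a p z * a01 b p q z + a01 a p q z * a12 b q z
                    + a12 a p z * Du q (a01 b p q) z * ucoord q z &
      forall h, h != q ->
        a11 a p z * Du h (a01 b p q) z * ucoord q z = 0 /\
        a12 a p z * Du h (a01 b p q) z * ucoord q z = 0].
Proof.
move=> J pq.
set E0 := \sum_l _ + _.
have E h s t s' t' :
    f01 f p q z * ucoord q z + f11 f p q z * two_delta h q s s' q
    + f12 f p q z * two_delta h q t t' q =
    (E0 + (Du h (a01 b p q) z * (a11 a p z * s + a12 a p z * t)
           + Du q (a01 b p q) z * (a11 a p z * s' + a12 a p z * t')))
      * ucoord q z
    + a01 a p q z * (a11 b q z * two_delta h q s s' q
                     + a12 b q z * two_delta h q t t' q)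
    + a01 b p q z * (a11 a p z * two_delta h q s s' q
                     + a12 a p z * two_delta h q t t' q).
  have := J p q (two_delta h q s s') (two_delta h q t t') 0 0 0.
  by rewrite /jet_mxop2 /jet_mul /= (negPf pq) !addr0 sum_two_delta.
have [|E00 E10 E01] := @off_identity (f01 f p q z) (f11 f p q z) (f12 f p q z)
  (ucoord q z) E0 (a01 a p q z) (a11 b q z) (a12 b q z) (a01 b p q z)
  (a11 a p z) (a12 a p z) (Du q (a01 b p q) z).
  move=> s t; have := E q 0 0 s t.
  by rewrite !two_delta_same !(mulr0, add0r).
split=> // h hq; apply: (@off_identity_other (f01 f p q z) _ E0) => s t.
have := E h s t 0 0.
rewrite !two_delta_other // !(mulr0, addr0) => Jz; exact: Jz.
Qed.

(** On the diagonal the monomials of degree two in the first derivatives appear.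
    The monomial d1 p * d2 p mixes the two coefficients of the right factor,
    whence the sum in the last equation of the first part; for h <> p all
    monomials are separate. *)
Lemma jet_identity_diag f a b z p : jet_identity f a b z ->
  [/\ (f01 f p p z - (\sum_(l < m) a01 a p l z * a01 b l p z
                      + Lop a p (a01 b p p) z)) * ucoord p z = 0,
      f11 f p p z = a01 a p p z * a11 b p z + a11 a p z * a01 b p p z
                    + Lop a p (a11 b p) z
                    + a11 a p z * Du p (a01 b p p) z * ucoord p z,
      f12 f p p z = a01 a p p z * a12 b p z + a12 a p z * a01 b p p z
                    + Lop a p (a12 b p) z
                    + a12 a p z * Du p (a01 b p p) z * ucoord p z,
      [/\ f21 f p z = a11 a p z * a11 b p z,
          f22 f p z + f23 f p z
            = a12 a p z * a11 b p z + a11 a p z * a12 b p z &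
          f24 f p z = a12 a p z * a12 b p z] &
      [/\ a11 a p z * Du p (a11 b p) z = 0, a12 a p z * Du p (a12 b p) z = 0 &
          a11 a p z * Du p (a12 b p) z + a12 a p z * Du p (a11 b p) z = 0]] /\
  forall h, h != p ->
    [/\ a11 a p z * Du h (a01 b p p) z * ucoord p z = 0,
        a12 a p z * Du h (a01 b p p) z * ucoord p z = 0,
        a11 a p z * Du h (a11 b p) z = 0 /\ a12 a p z * Du h (a11 b p) z = 0 &
        a11 a p z * Du h (a12 b p) z = 0 /\ a12 a p z * Du h (a12 b p) z = 0].
Proof.
move=> J; split.
  apply: diag_identity => s t w11 w12 w22.
  have := J p p (two_delta p p 0 s) (two_delta p p 0 t) w11 w12 w22.
  rewrite /jet_mxop2 /jet_mul /= eqxx !sum_two_delta.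
  by rewrite !two_delta_same !(mulr0, add0r).
move=> h hp; apply: diag_identity_other => s t s' t'.
have := J p p (two_delta h p s s') (two_delta h p t t') 0 0 0.
rewrite /jet_mxop2 /jet_mul /= eqxx !sum_two_delta.
rewrite !two_delta_other // !(mulr0, addr0) => Jz; exact: Jz.
Qed.

End Coefficients.

(** * Division by factors that are nonzero on a dense set *)

Section Density.
Context {R : realType}.

Lemma continuous_eq0_closure (T : topologicalType) (S : set T) (g : T -> R) z :
  {for z, continuous g} -> closure S z -> (forall y, S y -> g y = 0) -> g z = 0.
Proof.
move=> cg Sz g0; apply/eqP/negPn/negP => gz.
have nz : \forall y \near z, g y != 0.
  by move/cvgr_neq0: cg => /(_ gz).
by have [y [Sy]] := Sz _ nz; rewrite /= (g0 y Sy) eqxx.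
Qed.

Context {n : nat}.
Implicit Types (A : set 'rV[R]_n) (g h : 'rV[R]_n -> R).

Lemma C0D A g h : C0_on A g -> C0_on A h -> C0_on A (fun z => g z + h z).
Proof. by move=> cg ch z Az; apply: continuousD; [exact: cg|exact: ch]. Qed.

Lemma C0B A g h : C0_on A g -> C0_on A h -> C0_on A (fun z => g z - h z).
Proof. by move=> cg ch z Az; apply: continuousB; [exact: cg|exact: ch]. Qed.

Lemma C0M A g h : C0_on A g -> C0_on A h -> C0_on A (fun z => g z * h z).
Proof. by move=> cg ch z Az; apply: continuousM; [exact: cg|exact: ch]. Qed.

Lemma C0_sum A k (g : 'I_k -> 'rV[R]_n -> R) :
  (forall l, C0_on A (g l)) -> C0_on A (fun z => \sum_l g l z).
Proof.
move=> cg; rewrite (_ : (fun z => _) = \sum_l g l); last first.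
  by apply/funext => z; rewrite fct_sumE.
elim/big_ind: _ => [z _|g1 g2|l _]; [exact: cst_continuous|exact: C0D|exact: cg].
Qed.

Lemma C1_C0 A g : C1_on A g -> C0_on A g.
Proof. by move=> [dg _] z Az; apply/differentiable_continuous/dg. Qed.

(** Near a point where the coordinate vanishes, move it along its own axis. *)
Lemma coord_neq0_dense A (j : 'I_n) :
  open A -> A `<=` closure [set y | A y /\ y 0 j != 0].
Proof.
move=> oA z Az B Bz.
have [z0|z0] := eqVneq (z 0 j) 0; last first.
  by exists z; split; [split|exact: nbhs_singleton].
have line : (fun t : R => z + t *: delta_mx 0 j) @ (0 : R) --> z.
  rewrite -[X in _ --> X]addr0 -(scale0r (delta_mx 0 j)).
  apply: cvgD; first exact: cvg_cst.
  by apply: cvgZr_tmp; exact: cvg_id.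
have AB : nbhs z (A `&` B) by apply: filterI => //; exact: open_nbhs_nbhs.
have /nbhs_dnbhs near0 := line _ AB.
have [t [[At Bt] t0]] := filter_ex (filterI near0 (nbhs_dnbhs_neq (0 : R))).
exists (z + t *: delta_mx 0 j); split => //; split => //.
by rewrite !mxE z0 !eqxx add0r mulr1.
Qed.

End Density.

(** * From the jet identity to the conditions *)

Section Necessity.
Context {R : realType} {m : nat}.
Implicit Types (f : coeffs2 R m) (a b : coeffs1 R m) (A : set 'rV[R]_(2 + m)).

Lemma divide_ucoord A (g : 'rV[R]_(2 + m) -> R) q : open A -> C0_on A g ->
  (forall z, A z -> g z * ucoord q z = 0) -> forall z, A z -> g z = 0.
Proof.
move=> oA cg gu z Az; apply: continuous_eq0_closure.
- exact: cg.
- exact: (coord_neq0_dense (rshift 2 q) oA Az).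
- move=> y [Ay yq]; have /eqP := gu y Ay.
  by rewrite mulf_eq0 [ucoord q y == 0](negPf yq) orbF => /eqP.
Qed.

(** The pair of coefficients of L_p is the symbol of the left factor; order one
    means that it is nonzero on a dense set. *)
Lemma divide_symbol A a p (g : 'rV[R]_(2 + m) -> R) :
  of_order_one A a -> C0_on A g ->
  (forall z, A z -> a11 a p z != 0 \/ a12 a p z != 0 -> g z = 0) ->
  forall z, A z -> g z = 0.
Proof.
move=> oa cg g0 z Az; apply: (continuous_eq0_closure (cg z Az) (oa p z Az)).
by move=> y [Ay ay]; exact: g0.
Qed.

(** The second order coefficients are f21 = a11 b11, f22 + f23 = a12 b11 + a11 b12
    and f24 = a12 b12, so they all vanish where a11 and a12 do. *)
Lemma jet_identity_order A f a b : of_order_two A f ->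
  (forall z, A z -> jet_identity f a b z) -> of_order_one A a.
Proof.
move=> of2 J p z Az; apply: closureS (of2 p z Az) => y [Ay fy]; split=> //.
have [[_ _ _ [e1 e2 e3] _] _] := jet_identity_diag p (J y Ay).
rewrite e1 e2 e3 in fy.
have [a1|] := eqVneq (a11 a p y) 0; last by left.
have [a2|] := eqVneq (a12 a p y) 0; last by right.
by move: fy; rewrite a1 a2 !mul0r addr0 eqxx => -[].
Qed.

(** The equations without spurious factor hold pointwise.  The others are
    divided by the unknown, and the conditions on the derivatives with respect
    to the unknowns also by the symbol of L_p; all functions to which division
    is applied are continuous because the right factor is C^1. *)
Lemma jet_identity_conditions A f a b : open A ->
  coeffs2_C0 A f -> coeffs1_C0 A a -> coeffs1_C1 A b -> of_order_one A a ->
  (forall z, A z -> jet_identity f a b z) -> decomposition_conditions A f a b.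
Proof.
move=> oA [cf _] [ca0 ca1] [cb0 cb1] oa J.
have cD h p q : C0_on A (Du h (a01 b p q)) by exact: (cb0 p q).2.
have cD1 h p : C0_on A (Du h (a11 b p)) by exact: ((cb1 p).1).2.
have cD2 h p : C0_on A (Du h (a12 b p)) by exact: ((cb1 p).2).2.
have cL p q : C0_on A (Lop a p (a01 b p q)).
  by apply: C0D; apply: C0M; [exact: (ca1 p).1|exact: (cb0 p q).2
    |exact: (ca1 p).2|exact: (cb0 p q).2].
have cg p q : C0_on A (fun z => f01 f p q z -
    (\sum_(l < m) a01 a p l z * a01 b l q z + Lop a p (a01 b p q) z)).
  apply: C0B; first by have [] := cf p q.
  apply: C0D => //; apply: C0_sum => l; apply: C0M => //.
  exact/C1_C0/cb0.
have f01E p q z : A z -> f01 f p q z =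
    \sum_(l < m) a01 a p l z * a01 b l q z + Lop a p (a01 b p q) z.
  move=> Az; apply: subr0_eq; move: z Az; apply: (divide_ucoord oA (cg p q)).
  move=> z Az; have [<-|pq] := eqVneq p q.
    by have [[E _ _ _ _] _] := jet_identity_diag p (J z Az); exact: E.
  by have [E _ _ _] := jet_identity_off (J z Az) pq; exact: E.
have D0 h p q z : A z -> h != q -> Du h (a01 b p q) z = 0.
  move=> Az hq; move: z Az.
  have z12 z : A z -> a11 a p z * Du h (a01 b p q) z * ucoord q z = 0 /\
                      a12 a p z * Du h (a01 b p q) z * ucoord q z = 0.
    move=> Az; have [pq|pq] := eqVneq p q.
      by rewrite -pq in hq *; have [_ /(_ h hq)[]] := jet_identity_diag p (J z Az).
    by have [_ _ _ /(_ h hq)] := jet_identity_off (J z Az) pq.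
  have c1 : C0_on A (fun z => a11 a p z * Du h (a01 b p q) z).
    by apply: C0M => //; exact: (ca1 p).1.
  have c2 : C0_on A (fun z => a12 a p z * Du h (a01 b p q) z).
    by apply: C0M => //; exact: (ca1 p).2.
  have z1 := divide_ucoord oA c1 (fun z Az => (z12 z Az).1).
  have z2 := divide_ucoord oA c2 (fun z Az => (z12 z Az).2).
  apply: (divide_symbol (p := p) oa (cD h p q)) => z Az [a0|a0].
    exact: (mulfI a0 (etrans (z1 z Az) (esym (mulr0 _)))).
  exact: (mulfI a0 (etrans (z2 z Az) (esym (mulr0 _)))).
have D12 h p z : A z -> a11 a p z != 0 \/ a12 a p z != 0 ->
    Du h (a11 b p) z = 0 /\ Du h (a12 b p) z = 0.
  move=> Az a0; have [[_ _ _ _ [e11 e22 e12]] off] := jet_identity_diag p (J z Az).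
  have cancel (c d : R) : c != 0 -> c * d = 0 -> d = 0.
    by move=> c0 cd; apply: (mulfI c0); rewrite cd mulr0.
  have [hp|hp] := eqVneq h p; last first.
    have [_ _ [h1 h1'] [h2 h2']] := off h hp.
    by case: a0 => a0; split; apply: cancel a0 _.
  (* If a11 is nonzero, the derivative of b11 vanishes by the equation e11 and
     then that of b12 by e12; symmetrically for a12. *)
  rewrite hp; case: a0 => a0.
    have d1 := cancel _ _ a0 e11; split=> //.
    by apply: cancel a0 _; rewrite d1 mulr0 addr0 in e12.
  have d2 := cancel _ _ a0 e22; split=> //.
  by apply: cancel a0 _; rewrite d2 mulr0 add0r in e12.
have D1 h p := divide_symbol oa (cD1 h p) (fun z Az az => (D12 h p z Az az).1).
have D2 h p := divide_symbol oa (cD2 h p) (fun z Az az => (D12 h p z Az az).2).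
move=> z Az; split=> [p|p q pq].
  have [[_ e1 e2 [e3 e4 e5] _] _] := jet_identity_diag p (J z Az).
  split; first exact: f01E.
  do 5![split=> //]; split; first by move=> h hp; rewrite D0.
  by split=> h; rewrite ?D1 ?D2.
have [_ e1 e2 _] := jet_identity_off (J z Az) pq.
split; first exact: f01E.
by do 2![split=> //]; move=> h hq; rewrite D0.
Qed.

End Necessity.

Lemma open_prod_dom (R : realType) (m : nat) (Lambda : set 'rV[R]_2)
    (Omega : set 'rV[R]_m) :
  open Lambda -> open Omega -> open (prod_dom Lambda Omega).
Proof.
move=> oL oO.
have -> : prod_dom Lambda Omega = lsubmx @^-1` Lambda `&` rsubmx @^-1` Omega by [].
apply: openI; apply: open_comp => // z _; apply: differentiable_continuous.
  exact: differentiable_lsubmx.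
exact: differentiable_rsubmx.
Qed.

Theorem proposition3p4 (R : realType) (m : nat) (hm : (2 <= m)%N)
    (Lambda : set 'rV[R]_2) (Omega : set 'rV[R]_m)
    (hLambda : open Lambda) (hOmega : open Omega)
    (f : coeffs2 R m) (hf : coeffs2_C0 (prod_dom Lambda Omega) f) :
  (forall a1 a2 : coeffs1 R m,
     coeffs1_C0 (prod_dom Lambda Omega) a1 ->
     coeffs1_C1 (prod_dom Lambda Omega) a2 ->
     (decomposition_conditions (prod_dom Lambda Omega) f a1 a2 ->
      mxop_eq Lambda Omega (mxop2 f) (mxop_mul (mxop1 a1) (mxop1 a2))) /\
     (of_order_one (prod_dom Lambda Omega) a1 ->
      mxop_eq Lambda Omega (mxop2 f) (mxop_mul (mxop1 a1) (mxop1 a2)) ->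
      decomposition_conditions (prod_dom Lambda Omega) f a1 a2)) /\
  (of_order_two (prod_dom Lambda Omega) f ->
   ((exists a1 a2 : coeffs1 R m,
       [/\ coeffs1_C0 (prod_dom Lambda Omega) a1,
           coeffs1_C1 (prod_dom Lambda Omega) a2 &
           mxop_eq Lambda Omega (mxop2 f) (mxop_mul (mxop1 a1) (mxop1 a2))]) <->
    (exists a1 a2 : coeffs1 R m,
       [/\ coeffs1_C0 (prod_dom Lambda Omega) a1,
           coeffs1_C1 (prod_dom Lambda Omega) a2 &
           decomposition_conditions (prod_dom Lambda Omega) f a1 a2]))).
Proof.
have oA := open_prod_dom hLambda hOmega.
have sufficient a1 a2 : coeffs1_C1 (prod_dom Lambda Omega) a2 ->
    decomposition_conditions (prod_dom Lambda Omega) f a1 a2 ->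
    mxop_eq Lambda Omega (mxop2 f) (mxop_mul (mxop1 a1) (mxop1 a2)).
  move=> ca2 cond; apply/mxop_eq_jetP => // z Az.
  by have [diag off] := cond z Az; exact: conditions_jet.
split=> [a1 a2 ca1 ca2|f2].
  split=> [|oa1 /mxop_eq_jetP J]; first exact: sufficient.
  by apply: jet_identity_conditions => //; exact: J.
split=> -[a1 [a2 [ca1 ca2 E]]]; exists a1, a2; split=> //; last exact: sufficient.
have J := iffLR (mxop_eq_jetP f a1 hLambda hOmega ca2) E.
by apply: jet_identity_conditions => //; apply: jet_identity_order f2 J.
Qed.
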